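(* Let $N\in\mathbb N$ and let $\overline{\Gamma(N)}\le \mathrm{PSL}_2(\mathbb Z)$ be the image of the principal congruence subgroup $\Gamma(N)=\{A\in\mathrm{SL}_2(\mathbb Z): A\equiv 1 \pmod N\}$. (i) The number $n(N)$ of congruence lifts of $\overline{\Gamma(N)}$ is exactly \[ n(N)=\begin{cases}1 & \text{if } N=1,\\ 3 & \text{if } N>1 \text{ is odd},\\ 5 & \text{if } N=2,\\ 9 & \text{if } N>2 \text{ is even}.\end{cases} \] (ii) If $N>2$, then $\overline{\Gamma(N)}$ has noncongruence lifts.
   Context: For a subgroup $\Gamma\le\mathrm{SL}_2(\mathbb Z)$, $\overline\Gamma$ denotes its image in $\mathrm{PSL}_2(\mathbb Z)=\mathrm{SL}_2(\mathbb Z)/\{\pm1\}$. A lift of a subgroup $\overline\Gamma\le \mathrm{PSL}_2(\mathbb Z)$ is any subgroup of $\mathrm{SL}_2(\mathbb Z)$ whose image in $\mathrm{PSL}_2(\mathbb Z)$ equals $\overline\Gamma$. A subgroup of $\mathrm{SL}_2(\mathbb Z)$ is a congruence subgroup if it contains $\Gamma(M)$ for some $M\in\mathbb N$; a congruence lift is a lift which is a congruence subgroup, and a noncongruence lift is a lift which is not. *)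

(* Defs.v *)
From HB Require Import structures.
From mathcomp Require Import all_boot all_order all_algebra.
From mathcomp Require Import classical_sets cardinality.

Set Implicit Arguments.
Unset Strict Implicit.
Unset Printing Implicit Defensive.

Import GRing.Theory.
Local Open Scope ring_scope.
Local Open Scope quotient_scope.

Definition SL2Z : Type := {A : 'M[int]_2 | \det A == 1}.

HB.instance Definition _ := Choice.on SL2Z.

Definition sl2_mx (A : SL2Z) : 'M[int]_2 := val A.

Lemma sl2_one_subproof : \det (1%:M : 'M[int]_2) == 1.
Proof. by rewrite det1. Qed.

Lemma sl2_mul_subproof (A B : SL2Z) : \det (sl2_mx A *m sl2_mx B) == 1.
Proof. by rewrite det_mulmx (eqP (valP A)) (eqP (valP B)) mulr1. Qed.

Lemma sl2_unit (A : SL2Z) : sl2_mx A \in unitmx.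
Proof. by rewrite unitmxE (eqP (valP A)) unitr1. Qed.

Lemma sl2_inv_subproof (A : SL2Z) : \det (invmx (sl2_mx A)) == 1.
Proof. by rewrite det_inv (eqP (valP A)) invr1. Qed.

Definition sl2_one : SL2Z := Sub 1%:M sl2_one_subproof.
Definition sl2_mul (A B : SL2Z) : SL2Z :=
  Sub (sl2_mx A *m sl2_mx B) (sl2_mul_subproof A B).
Definition sl2_inv (A : SL2Z) : SL2Z :=
  Sub (invmx (sl2_mx A)) (sl2_inv_subproof A).

Lemma sl2_mulA : associative sl2_mul.
Proof. by move=> A B C; apply/val_inj; rewrite /= mulmxA. Qed.
Lemma sl2_mul1 : left_id sl2_one sl2_mul.
Proof. by move=> A; apply/val_inj; rewrite /= mul1mx. Qed.
Lemma sl2_mulr1 : right_id sl2_one sl2_mul.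
Proof. by move=> A; apply/val_inj; rewrite /= mulmx1. Qed.
Lemma sl2_mulV : left_inverse sl2_one sl2_inv sl2_mul.
Proof. by move=> A; apply/val_inj; rewrite /= mulVmx ?sl2_unit. Qed.
Lemma sl2_mulrV : right_inverse sl2_one sl2_inv sl2_mul.
Proof. by move=> A; apply/val_inj; rewrite /= mulmxV ?sl2_unit. Qed.

HB.instance Definition _ :=
  isGroup.Build SL2Z sl2_mulA sl2_mul1 sl2_mulr1 sl2_mulV sl2_mulrV.

Lemma sl2_opp1_subproof : \det (- 1%:M : 'M[int]_2) == 1.
Proof. by rewrite -scaleN1r detZ det1. Qed.

Definition sl2_opp1 : SL2Z := Sub (- 1%:M) sl2_opp1_subproof.

(* A and B have the same class modulo {1, -1}. *)
Definition pm1_equiv (A B : SL2Z) : bool :=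
  ((A * B^-1 == 1) || (A * B^-1 == sl2_opp1))%g.

Lemma sl2_opp1E (A : SL2Z) : sl2_mx (sl2_opp1 * A)%g = - sl2_mx A.
Proof. by rewrite /sl2_mx /= mulNmx mul1mx. Qed.

Lemma sl2_opp1C (A : SL2Z) : (A * sl2_opp1 = sl2_opp1 * A)%g.
Proof. by apply/val_inj; rewrite /= mulNmx mul1mx mulmxN mulmx1. Qed.

Lemma sl2_opp1K : (sl2_opp1 * sl2_opp1 = 1)%g.
Proof. by apply/val_inj; rewrite /= mulNmx mul1mx opprK. Qed.

Lemma sl2_opp1V : (sl2_opp1^-1 = sl2_opp1)%g.
Proof. by rewrite -[LHS]mulg1 -sl2_opp1K mulKg. Qed.

Lemma pm1_equivP (A B : SL2Z) :
  reflect (A = B \/ A = sl2_opp1 * B)%g (pm1_equiv A B).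
Proof.
apply: (iffP orP) => -[].
- by move/eqP=> h; left; rewrite -[LHS](mulgVK B) h mul1g.
- by move/eqP=> h; right; rewrite -[LHS](mulgVK B) h.
- by move=> ->; left; rewrite mulgV.
- by move=> ->; right; rewrite mulgK.
Qed.

Lemma pm1_equiv_refl : reflexive pm1_equiv.
Proof. by move=> A; apply/pm1_equivP; left. Qed.

Lemma pm1_equiv_imp A B : pm1_equiv A B -> pm1_equiv B A.
Proof.
move/pm1_equivP=> [->|->]; apply/pm1_equivP; first by left.
by right; rewrite mulgA sl2_opp1K mul1g.
Qed.

Lemma pm1_equiv_sym : symmetric pm1_equiv.
Proof. by move=> A B; apply/idP/idP; apply: pm1_equiv_imp. Qed.

Lemma pm1_equiv_trans : transitive pm1_equiv.
Proof.
move=> B A C /pm1_equivP[->|->] // /pm1_equivP[->|->]; apply/pm1_equivP.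
  by right.
by left; rewrite mulgA sl2_opp1K mul1g.
Qed.

Canonical pm1_equiv_rel :=
  EquivRel pm1_equiv pm1_equiv_refl pm1_equiv_sym pm1_equiv_trans.

Definition PSL2Z : Type := {eq_quot pm1_equiv_rel}.

HB.instance Definition _ := Choice.on PSL2Z.
HB.instance Definition _ := EqQuotient.on PSL2Z.

Definition psl2_pi (A : SL2Z) : PSL2Z := \pi_PSL2Z A.

Lemma psl2_piP (A B : SL2Z) :
  psl2_pi A = psl2_pi B <-> (A = B \/ A = sl2_opp1 * B)%g.
Proof. by split=> [/eqmodP/pm1_equivP|/pm1_equivP/eqmodP]. Qed.

Lemma psl2_reprK (x : PSL2Z) : psl2_pi (repr x) = x.
Proof. exact: reprK. Qed.

Definition psl2_one : PSL2Z := psl2_pi 1%g.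
Definition psl2_mul (x y : PSL2Z) : PSL2Z := psl2_pi (repr x * repr y)%g.
Definition psl2_inv (x : PSL2Z) : PSL2Z := psl2_pi (repr x)^-1%g.

Lemma psl2_mulE (A B : SL2Z) :
  psl2_mul (psl2_pi A) (psl2_pi B) = psl2_pi (A * B)%g.
Proof.
have /psl2_piP[hA|hA] := psl2_reprK (psl2_pi A);
have /psl2_piP[hB|hB] := psl2_reprK (psl2_pi B);
apply/psl2_piP; rewrite hA hB.
- by left.
- by right; rewrite !mulgA sl2_opp1C.
- by right; rewrite !mulgA.
- by left; rewrite -sl2_opp1C -mulgA (mulgA sl2_opp1) sl2_opp1K mul1g.
Qed.

Lemma psl2_invE (A : SL2Z) : psl2_inv (psl2_pi A) = psl2_pi A^-1%g.
Proof.
have /psl2_piP[hA|hA] := psl2_reprK (psl2_pi A); apply/psl2_piP; rewrite hA.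
  by left.
by right; rewrite invgM sl2_opp1V sl2_opp1C.
Qed.

Lemma psl2_mulA : associative psl2_mul.
Proof.
move=> x y z; rewrite -[x]psl2_reprK -[y]psl2_reprK -[z]psl2_reprK.
by rewrite !psl2_mulE mulgA.
Qed.
Lemma psl2_mul1 : left_id psl2_one psl2_mul.
Proof. by move=> x; rewrite -[x]psl2_reprK psl2_mulE mul1g. Qed.
Lemma psl2_mulr1 : right_id psl2_one psl2_mul.
Proof. by move=> x; rewrite -[x]psl2_reprK psl2_mulE mulg1. Qed.
Lemma psl2_mulV : left_inverse psl2_one psl2_inv psl2_mul.
Proof. by move=> x; rewrite -[x]psl2_reprK psl2_invE psl2_mulE mulVg. Qed.
Lemma psl2_mulrV : right_inverse psl2_one psl2_inv psl2_mul.
Proof. by move=> x; rewrite -[x]psl2_reprK psl2_invE psl2_mulE mulgV. Qed.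

HB.instance Definition _ :=
  isGroup.Build PSL2Z psl2_mulA psl2_mul1 psl2_mulr1 psl2_mulV psl2_mulrV.

Lemma psl2_piM : {morph psl2_pi : A B / (A * B)%g >-> (A * B)%g}.
Proof. by move=> A B; rewrite -psl2_mulE. Qed.

Local Open Scope classical_set_scope.

Definition is_subgroup (gT : groupType) (G : set gT) : Prop :=
  [/\ G 1%g,
      forall x y, G x -> G y -> G (x * y)%g
    & forall x, G x -> G (x^-1)%g].

Definition Gamma (N : nat) : set SL2Z :=
  [set A | forall i j : 'I_2,
     (sl2_mx A i j = (1%:M : 'M[int]_2) i j %[mod N%:Z])%Z].

Definition psl2_image (G : set SL2Z) : set PSL2Z := psl2_pi @` G.

Definition is_lift (H : set PSL2Z) (G : set SL2Z) : Prop :=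
  is_subgroup G /\ psl2_image G = H.

(* The level M is positive: Gamma 0 is the trivial group. *)
Definition is_congruence (G : set SL2Z) : Prop :=
  is_subgroup G /\ exists M : nat, (0 < M)%N /\ Gamma M `<=` G.

Definition congruence_lift (H : set PSL2Z) (G : set SL2Z) : Prop :=
  is_lift H G /\ is_congruence G.

Definition noncongruence_lift (H : set PSL2Z) (G : set SL2Z) : Prop :=
  is_lift H G /\ ~ is_congruence G.

(* Main.v *)
(** A lift of the image of Gamma(N) that avoids -1 is the graph
    {chi(A) A : A in Gamma(N)} of a character chi : Gamma(N) -> {1, -1}, and the
    only lift containing -1 is the full preimage.

    If chi is trivial on some Gamma(M), it is trivial on Gamma(2N): modulo M an
    element of Gamma(2N) is a product of squares and commutators of elements of
    Gamma(N). So congruence lifts amount to characters of Gamma(N) / Gamma(2N),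
    which is SL_2(F_2) = S_3 for N odd and (Z/2)^3 for N even.

    For N > 2, let chi(x) be the parity of the number of translates under
    Gamma(N) of the Farey edge (0, oo) which separate z = exp(i pi / 3) from
    x z. This is a character. It is nontrivial on Gamma(2N): the product of the
    two parabolic elements V^N and L^2 V^N L^-2, with V : z -> z - 1 and
    L : z -> z / (z + 1), lies in Gamma(2N), and the edge ends at the cusp fixed
    by the first one but at no cusp equivalent to the one fixed by the second. *)
Require Import Defs.
From HB Require Import structures.
From mathcomp Require Import all_boot all_order all_algebra.
From mathcomp Require Import boolp classical_sets functions cardinality fsbigop.
From mathcomp Require Import zify ring.

Set Implicit Arguments.
Unset Strict Implicit.
Unset Printing Implicit Defensive.

Import Order.TTheory GRing.Theory Num.Theory.

(** * Entries and elementary matrices *)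

Section Entries.
Local Open Scope ring_scope.

Definition e11 (A : SL2Z) : int := sl2_mx A ord0 ord0.
Definition e12 (A : SL2Z) : int := sl2_mx A ord0 ord_max.
Definition e21 (A : SL2Z) : int := sl2_mx A ord_max ord0.
Definition e22 (A : SL2Z) : int := sl2_mx A ord_max ord_max.

Lemma ord2P (P : 'I_2 -> Prop) : P ord0 -> P ord_max -> forall i, P i.
Proof.
move=> P0 P1 [[|[|//]] hi]; first by rewrite (_ : Ordinal hi = ord0) //; apply/val_inj.
by rewrite (_ : Ordinal hi = ord_max) //; apply/val_inj.
Qed.

Lemma sl2_ext (A B : SL2Z) :
  e11 A = e11 B -> e12 A = e12 B -> e21 A = e21 B -> e22 A = e22 B -> A = B.
Proof.
move=> h11 h12 h21 h22; apply/val_inj/matrixP.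
by apply: ord2P; apply: ord2P.
Qed.

Lemma sl2_det (A : SL2Z) : e11 A * e22 A - e12 A * e21 A = 1.
Proof.
rewrite -(eqP (valP A)) /= (expand_det_row _ ord0) !big_ord_recl big_ord0.
rewrite /cofactor !det_mx11 !mxE /= /e11 /e12 /e21 /e22 /sl2_mx.
have -> : lift ord0 ord0 = ord_max :> 'I_2 by apply/val_inj.
have -> : lift ord_max ord0 = ord0 :> 'I_2 by apply/val_inj.
rewrite expr0 expr1; ring.
Qed.

Lemma e11M (A B : SL2Z) : e11 (A * B)%g = e11 A * e11 B + e12 A * e21 B.
Proof.
rewrite /e11 /sl2_mx /= mxE !big_ord_recl big_ord0 addr0.
by have -> : lift ord0 ord0 = ord_max :> 'I_2 by apply/val_inj.
Qed.

Lemma e12M (A B : SL2Z) : e12 (A * B)%g = e11 A * e12 B + e12 A * e22 B.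
Proof.
rewrite /e12 /sl2_mx /= mxE !big_ord_recl big_ord0 addr0.
by have -> : lift ord0 ord0 = ord_max :> 'I_2 by apply/val_inj.
Qed.

Lemma e21M (A B : SL2Z) : e21 (A * B)%g = e21 A * e11 B + e22 A * e21 B.
Proof.
rewrite /e21 /sl2_mx /= mxE !big_ord_recl big_ord0 addr0.
by have -> : lift ord0 ord0 = ord_max :> 'I_2 by apply/val_inj.
Qed.

Lemma e22M (A B : SL2Z) : e22 (A * B)%g = e21 A * e12 B + e22 A * e22 B.
Proof.
rewrite /e22 /sl2_mx /= mxE !big_ord_recl big_ord0 addr0.
by have -> : lift ord0 ord0 = ord_max :> 'I_2 by apply/val_inj.
Qed.

Definition eM := (e11M, e12M, e21M, e22M).

Definition mx22 (a b c d : int) : 'M[int]_2 :=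
  \matrix_(i, j) if i == ord0 then (if j == ord0 then a else b)
                 else (if j == ord0 then c else d).

Lemma mx22_det (a b c d : int) : a * d - b * c = 1 -> \det (mx22 a b c d) == 1.
Proof.
move=> h; rewrite (expand_det_row _ ord0) !big_ord_recl big_ord0.
rewrite /cofactor !det_mx11 !mxE /= expr0 expr1; apply/eqP; rewrite -[RHS]h; ring.
Qed.

Definition sl2_of (a b c d : int) (h : a * d - b * c = 1) : SL2Z := Sub (mx22 a b c d) (mx22_det h).

Lemma sl2_ofE (a b c d : int) (h : a * d - b * c = 1) :
  ((e11 (sl2_of h) = a) * (e12 (sl2_of h) = b) *
   (e21 (sl2_of h) = c) * (e22 (sl2_of h) = d))%type.
Proof. by rewrite /e11 /e12 /e21 /e22 /sl2_mx /= !mxE. Qed.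

Lemma e1 : ((e11 1%g = 1) * (e12 1%g = 0) * (e21 1%g = 0) * (e22 1%g = 1))%type.
Proof. by rewrite /e11 /e12 /e21 /e22 /sl2_mx /= !mxE. Qed.

Lemma eN1 : ((e11 sl2_opp1 = -1) * (e12 sl2_opp1 = 0) * (e21 sl2_opp1 = 0)
             * (e22 sl2_opp1 = -1))%type.
Proof. by rewrite /e11 /e12 /e21 /e22 /sl2_mx /= !mxE. Qed.

Lemma sl2_adj (A : SL2Z) : e22 A * e11 A - (- e12 A) * (- e21 A) = 1.
Proof. rewrite -(sl2_det A); ring. Qed.

Lemma sl2_invE (A : SL2Z) : (A^-1)%g = sl2_of (sl2_adj A).
Proof.
apply: (mulgI A); rewrite mulgV; have h := sl2_det A.
by apply: sl2_ext; rewrite !eM !sl2_ofE !e1 -?[LHS]h; ring.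
Qed.

Lemma eV (A : SL2Z) : ((e11 A^-1%g = e22 A) * (e12 A^-1%g = - e12 A) *
   (e21 A^-1%g = - e21 A) * (e22 A^-1%g = e11 A))%type.
Proof. by rewrite sl2_invE !sl2_ofE. Qed.

Lemma upper_det (x : int) : 1 * 1 - x * 0 = 1 :> int. Proof. by ring. Qed.
Lemma lower_det (x : int) : 1 * 1 - 0 * x = 1 :> int. Proof. by ring. Qed.
Definition upper x := sl2_of (upper_det x).
Definition lower x := sl2_of (lower_det x).

Lemma upperE x : ((e11 (upper x) = 1) * (e12 (upper x) = x) *
   (e21 (upper x) = 0) * (e22 (upper x) = 1))%type.
Proof. by rewrite /upper !sl2_ofE. Qed.

Lemma lowerE x : ((e11 (lower x) = 1) * (e12 (lower x) = 0) *
   (e21 (lower x) = x) * (e22 (lower x) = 1))%type.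
Proof. by rewrite /lower !sl2_ofE. Qed.

Lemma upperD x y : upper (x + y) = (upper x * upper y)%g.
Proof. by apply: sl2_ext; rewrite !eM !upperE; ring. Qed.

Lemma lowerD x y : lower (x + y) = (lower x * lower y)%g.
Proof. by apply: sl2_ext; rewrite !eM !lowerE; ring. Qed.

End Entries.

(** * Principal congruence subgroups, entry by entry *)

Section PrincipalCongruence.
Local Open Scope ring_scope.

Lemma GammaP (N : nat) A : Gamma N A <->
  [/\ (N%:Z %| e11 A - 1)%Z, (N%:Z %| e12 A)%Z, (N%:Z %| e21 A)%Z
    & (N%:Z %| e22 A - 1)%Z].
Proof.
have hE i j : (sl2_mx A i j = (1%:M : 'M[int]_2) i j %[mod N%:Z])%Z <->
    (N%:Z %| sl2_mx A i j - (i == j)%:R)%Z.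
  by rewrite mxE -eqz_mod_dvd; split=> /eqP.
split=> [h|[h11 h12 h21 h22]].
  split; [have := h ord0 ord0 | have := h ord0 ord_max
    | have := h ord_max ord0 | have := h ord_max ord_max];
  by rewrite hE //= ?subr0.
by apply: ord2P; apply: ord2P; rewrite hE //= ?subr0.
Qed.

Lemma Gamma1 (N : nat) : Gamma N 1%g.
Proof. by apply/GammaP; rewrite !e1 subrr dvdz0. Qed.

Lemma GammaS (N M : nat) : (N %| M)%N -> (Gamma M `<=` Gamma N)%classic.
Proof.
move=> NM A /GammaP[h11 h12 h21 h22].
have NMz : (N%:Z %| M%:Z)%Z by [].
by apply/GammaP; split; apply: dvdz_trans NMz _.
Qed.

Lemma GammaV (N : nat) A : Gamma N A -> Gamma N A^-1%g.
Proof. by move=> /GammaP[h11 h12 h21 h22]; apply/GammaP; rewrite !eV !rpredN. Qed.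

Lemma Gamma_elt (N : nat) A : Gamma N A <-> exists x y z t,
  [/\ e11 A = 1 + N%:Z * x, e12 A = N%:Z * y, e21 A = N%:Z * z & e22 A = 1 + N%:Z * t].
Proof.
split=> [/GammaP[/dvdzP[x hx] /dvdzP[y hy] /dvdzP[z hz] /dvdzP[t ht]]|].
  by exists x, y, z, t; split; lia.
case=> x [y [z [t [hx hy hz ht]]]]; apply/GammaP.
by rewrite hx hy hz ht !(addrC 1) !addrK !dvdz_mulr.
Qed.

Lemma GammaM (N : nat) A B : Gamma N A -> Gamma N B -> Gamma N (A * B)%g.
Proof.
move=> /Gamma_elt[x [y [z [t [h1 h2 h3 h4]]]]] /Gamma_elt[x' [y' [z' [t' [k1 k2 k3 k4]]]]].
apply/Gamma_elt; rewrite !eM h1 h2 h3 h4 k1 k2 k3 k4.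
exists (x + x' + N%:Z * (x * x') + N%:Z * (y * z')),
  (y' + y + N%:Z * (x * y') + N%:Z * (y * t')),
  (z + z' + N%:Z * (z * x') + N%:Z * (t * z')),
  (t + t' + N%:Z * (z * y') + N%:Z * (t * t')).
by split; ring.
Qed.

Lemma Gamma_upper (N : nat) x : (N%:Z %| x)%Z -> Gamma N (upper x).
Proof. by move=> h; apply/GammaP; rewrite !upperE subrr dvdz0. Qed.

Lemma Gamma_lower (N : nat) x : (N%:Z %| x)%Z -> Gamma N (lower x).
Proof. by move=> h; apply/GammaP; rewrite !lowerE subrr dvdz0. Qed.

Lemma Gamma_opp1 (N : nat) : Gamma N sl2_opp1 <-> (N %| 2)%N.
Proof.
rewrite GammaP !eN1 dvdz0 (_ : -1 - 1 = - 2%:Z :> int) // rpredN.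
by split=> [[]|h].
Qed.

Definition eqmod (M : int) (A B : SL2Z) : Prop :=
  [/\ (M %| e11 A - e11 B)%Z, (M %| e12 A - e12 B)%Z,
      (M %| e21 A - e21 B)%Z & (M %| e22 A - e22 B)%Z].

(** A B^-1 - 1 = (A - B) B^-1, and [M] divides the right side. *)
Lemma eqmod_Gamma M (A B : SL2Z) : eqmod M%:Z A B -> Gamma M (A * B^-1)%g.
Proof.
case=> /dvdzP[x hx] /dvdzP[y hy] /dvdzP[z hz] /dvdzP[t ht].
have dB := sl2_det B.
apply/Gamma_elt; rewrite !eM !eV.
rewrite -(subrK (e11 B) (e11 A)) hx -(subrK (e12 B) (e12 A)) hy.
rewrite -(subrK (e21 B) (e21 A)) hz -(subrK (e22 B) (e22 A)) ht.
exists (x * e22 B - y * e21 B), (y * e11 B - x * e12 B),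
  (z * e22 B - t * e21 B), (t * e11 B - z * e12 B).
by split; rewrite -?dB; ring.
Qed.

End PrincipalCongruence.

(** * Congruence characters *)

Section CongruenceCharacters.
Local Open Scope ring_scope.

Lemma coprimez_shift (a q : int) (M : nat) :
  (0 < M)%N -> coprimez a q -> exists t : int, coprimez (a + t * q) M%:Z.
Proof.
move=> M0; rewrite coprimezE => aq.
(* t is the part of M prime to a, so each prime factor of M divides exactly
   one of a and t * q. *)
pose pi : nat_pred := [pred p | ~~ (p %| `|a|)%N].
exists (M`_pi)%N%:Z; rewrite coprimezE /= /coprime.
apply: contraT => ne1; set g := gcdn _ _ in ne1.
have g1 : (1 < g)%N by rewrite ltn_neqAle eq_sym ne1 gcdn_gt0 M0 orbT.
have pp := pdiv_prime g1; set p := pdiv g in pp.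
have pg : (p %| g)%N by exact: pdiv_dvd.
have pM : (p %| M)%N by apply: dvdn_trans pg (dvdn_gcdr _ _).
have pS : (p%:Z %| a + (M`_pi)%N%:Z * q)%Z.
  by rewrite dvdzE; apply: dvdn_trans pg (dvdn_gcdl _ _).
have [pa|pa] := boolP (p %| `|a|)%N.
  have paz : (p%:Z %| a)%Z by rewrite dvdzE.
  move: pS; rewrite rpredDl // dvdzE abszM Euclid_dvdM //= => /orP[pt|pq].
    have /(pnatP _ (part_gt0 pi M))/(_ p pp pt) := part_pnat pi M.
    by rewrite inE /= pa.
  have : (p %| gcdn `|a| `|q|)%N by rewrite dvdn_gcd pa.
  by rewrite (eqP aq) dvdn1 => /eqP p1; rewrite p1 in pp.
have pt : (p %| M`_pi)%N.
  by rewrite -(part_pnat_id (_ : pi.-nat p)) ?partn_dvd // pnatE // inE.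
have ptz : (p%:Z %| (M`_pi)%N%:Z * q)%Z by rewrite dvdz_mulr // dvdzE.
by move: pS; rewrite rpredDr // dvdzE (negbTE pa).
Qed.

(** Signs are written additively, [true] standing for -1. Values of [f] off Gamma(N) are arbitrary,
    so characters are compared on Gamma(N) only. *)
Definition is_char (N : nat) (f : SL2Z -> bool) : Prop :=
  forall A B, Gamma N A -> Gamma N B -> f (A * B)%g = f A (+) f B.

Section Char.
Variables (N : nat) (f : SL2Z -> bool).
Hypothesis fM : is_char N f.

Lemma char1 : f 1%g = false.
Proof. by have := fM (Gamma1 N) (Gamma1 N); rewrite mulg1 addbb. Qed.

Lemma charV A : Gamma N A -> f A^-1%g = f A.
Proof.
move=> hA; have := fM hA (GammaV hA); rewrite mulgV char1.
by case: (f A) => //=; case: (f _).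
Qed.

Lemma char_div A B : Gamma N A -> Gamma N B -> f (A * B^-1)%g = false -> f A = f B.
Proof.
move=> hA hB; rewrite fM ?charV //; last exact: GammaV.
by case: (f A) => //=; case: (f B).
Qed.

Lemma char_sqr A : Gamma N A -> f (A * A)%g = false.
Proof. by move=> hA; rewrite fM ?addbb. Qed.

Variable M : nat.
Hypothesis M0 : (0 < M)%N.
Hypothesis NM : (N.*2 %| M)%N.
Hypothesis fGM : forall A, Gamma M A -> f A = false.

Lemma char_eqmod A B : Gamma N A -> Gamma N B -> eqmod M%:Z A B -> f A = f B.
Proof. by move=> hA hB /eqmod_Gamma hAB; apply: char_div => //; apply: fGM. Qed.

(** The matrix is the square of an elementary matrix of Gamma(N). *)
Lemma char_upper2 x : ((N.*2)%:Z %| x)%Z -> f (upper x) = false.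
Proof.
move=> /dvdzP[k ->]; rewrite -addnn PoszD mulrDr.
rewrite upperD char_sqr //; apply: Gamma_upper; exact: dvdz_mull.
Qed.

Lemma char_lower2 x : ((N.*2)%:Z %| x)%Z -> f (lower x) = false.
Proof.
move=> /dvdzP[k ->]; rewrite -addnn PoszD mulrDr.
rewrite lowerD char_sqr //; apply: Gamma_lower; exact: dvdz_mull.
Qed.

Lemma dvdN2 x : ((N.*2)%:Z %| x)%Z -> (N%:Z %| x)%Z.
Proof. by apply: dvdz_trans; rewrite dvdzE /= -mul2n dvdn_mull. Qed.

(* Modulo M, B is obtained from A by multiplying on both sides by elementary
   matrices with entries in 2NZ, on which f vanishes. *)
Lemma char_eq_diag A B : Gamma N A -> Gamma N B ->
    coprimez (e11 A) M%:Z -> (M%:Z %| e11 A - e11 B)%Z ->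
    ((N.*2)%:Z %| e12 A - e12 B)%Z -> ((N.*2)%:Z %| e21 A - e21 B)%Z ->
  f A = f B.
Proof.
move=> hA hB /coprimezP[[a' v] /= ha'] h11 h12 h21.
(* [a'] inverts [e11 A] modulo [M], so these multipliers carry the off-diagonal entries of [A] to
   those of [B] modulo [M]. *)
pose x := a' * (e21 B - e21 A); pose y := a' * (e12 B - e12 A).
have hx : ((N.*2)%:Z %| x)%Z by rewrite dvdz_mull // -opprB rpredN.
have hy : ((N.*2)%:Z %| y)%Z by rewrite dvdz_mull // -opprB rpredN.
have gx : Gamma N (lower x) by apply: Gamma_lower; exact: dvdN2.
have gy : Gamma N (upper y) by apply: Gamma_upper; exact: dvdN2.
have gC : Gamma N (lower x * A * upper y)%g by apply: GammaM => //; exact: GammaM.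
have -> : f A = f (lower x * A * upper y)%g.
  by rewrite !fM ?char_lower2 ?char_upper2 ?addbF //; exact: GammaM.
apply: char_eqmod => //.
set C := (_ * _)%g in gC *.
have [u hu] : exists u, e11 A = e11 B + u * M%:Z.
  by case/dvdzP: h11 => u hu; exists u; rewrite -hu; ring.
have C11 : e11 C = e11 A by rewrite /C !eM !lowerE !upperE; ring.
have hinv : a' * e11 A = 1 - v * M%:Z by rewrite -ha' addrK.
have C12 : e12 C = e12 B - v * (e12 B - e12 A) * M%:Z.
  rewrite /C !eM !lowerE !upperE /y.
  rewrite [LHS](_ : _ = e12 A + (a' * e11 A) * (e12 B - e12 A)); last by ring.
  by rewrite hinv; ring.
have C21 : e21 C = e21 B - v * (e21 B - e21 A) * M%:Z.
  rewrite /C !eM !lowerE !upperE /x.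
  rewrite [LHS](_ : _ = e21 A + (a' * e11 A) * (e21 B - e21 A)); last by ring.
  by rewrite hinv; ring.
have c12 : (M%:Z %| e12 C - e12 B)%Z.
  by rewrite C12 addrC addKr rpredN dvdz_mull.
have c21 : (M%:Z %| e21 C - e21 B)%Z.
  by rewrite C21 addrC addKr rpredN dvdz_mull.
split=> //; first by rewrite C11.
(* the last entry is determined by the determinant, as e11 A is a unit mod M *)
have cop : coprimez M%:Z (e11 A).
  by rewrite coprimez_sym; apply/coprimezP; exists (a', v).
rewrite -(Gauss_dvdzr _ cop).
have -> : e11 A * (e22 C - e22 B) =
   (e12 C - e12 B) * e21 C + e12 B * (e21 C - e21 B) - u * e22 B * M%:Z.
  have dB := sl2_det B; have dC := sl2_det C; rewrite C11 in dC.
  transitivity ((e11 A * e22 C - e12 C * e21 C) + e12 C * e21 C - e11 A * e22 B); first by ring.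
  rewrite dC -dB {1}hu; ring.
apply: rpredB; last exact: dvdz_mull.
by apply: rpredD; [exact: dvdz_mulr | exact: dvdz_mull].
Qed.

Lemma char_comm A B : Gamma N A -> Gamma N B -> f (A^-1 * B * A * B^-1)%g = false.
Proof.
move=> hA hB; have vA := GammaV hA; have vB := GammaV hB.
have hAB := GammaM vA hB; have hABA := GammaM hAB hA.
by rewrite !fM // !charV //; case: (f A); case: (f B).
Qed.

(** By [char_eq_diag] it suffices to match [e11 A] modulo [M] by an element that [f] kills and whose
    off-diagonal entries lie in 2NZ. A square [B * B] matches it modulo N^2, and a commutator [C]
    corrects the rest. *)
Lemma char_Gamma2_unit A : Gamma N.*2 A -> coprimez (e11 A) M%:Z -> f A = false.
Proof.
move=> hA cA; have hNA : Gamma N A by apply: GammaS hA; rewrite -mul2n dvdn_mull.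
have NMz : (N%:Z %| M%:Z)%Z by apply: dvdN2.
have NM2 : (N%:Z * N%:Z %| M%:Z * M%:Z)%Z by exact: dvdz_mul.
have [s [b [c [d [hs hb hc hd]]]]] := (Gamma_elt _ _).1 hA.
pose q := N%:Z * N%:Z.
have cs : coprimez (1 + N%:Z * s) q.
  rewrite coprimezMr andbb; apply/coprimezP; exists (1, - s) => /=; ring.
have [t ct] := coprimez_shift M0 cs; set w := (_ + _) in ct.
(* w is an approximate square root of e11 A: w ^ 2 = e11 A mod N ^ 2 *)
have cw : coprimez w (M%:Z * M%:Z) by rewrite coprimezMr ct.
have [[w' v] /= hw'] := coprimezP _ _ cw.
(* The Bezout relation modulo M^2 leaves a factor M for each off-diagonal entry, so [B] is diagonal
   modulo M. *)
have detB : w * w' - (- M%:Z) * (v * M%:Z) = 1 by rewrite -hw'; ring.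
pose B := sl2_of detB.
have [m hm] := dvdzP NM2; have [m1 hm1] := dvdzP NMz.
have ww' : w' * w = 1 - v * (M%:Z * M%:Z) by rewrite -hw' addrK.
have hB : Gamma N B.
  apply/Gamma_elt; rewrite /B !sl2_ofE /w.
  exists (s + t * N%:Z), (- m1), (v * m1), (- (s + t * N%:Z) * w' - v * m * N%:Z).
  rewrite hm1; split; [rewrite /q; ring | ring | ring |].
  transitivity (w' * w - N%:Z * (s + t * N%:Z) * w'); first by rewrite /w /q; ring.
  rewrite ww' hm; ring.
(* Modulo M, 1 + q r is the quotient of [e11 A] by w^2; it is the upper left entry wanted for
   [C]. *)
have [r hr] : exists r, e11 A * (w' * w') = 1 + q * r.
  pose k := - (s * s + 2 * (1 + N%:Z * s) * t + t * t * q).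
  exists (- 2 * v * m + v * v * m * m * q + k * (w' * w')).
  transitivity ((w' * w) * (w' * w) + q * k * (w' * w')).
    by rewrite hs -addnn PoszD /k /w /q; ring.
  by rewrite ww' hm -/q; ring.
pose C := ((lower (N%:Z * r))^-1 * upper N%:Z * lower (N%:Z * r) * (upper N%:Z)^-1)%g.
have gl : Gamma N (lower (N%:Z * r)) by apply: Gamma_lower; exact: dvdz_mulr.
have gu : Gamma N (upper N%:Z) by exact: Gamma_upper.
have fC : f C = false by exact: char_comm.
have gC : Gamma N C.
  by do ![exact: GammaV | apply: GammaM | exact: gl | exact: gu].
have C11 : e11 C = 1 + q * r.
  by rewrite /C !eM !eV !lowerE !upperE /q; ring.
have C12 : e12 C = - (N%:Z * q * r).
  by rewrite /C !eM !eV !lowerE !upperE /q; ring.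
have C21 : e21 C = - (N%:Z * q * r * r).
  by rewrite /C !eM !eV !lowerE !upperE /q; ring.
(* [e11 A] is 1 modulo 2N and [w'] is a unit modulo the even number [M]: both are odd, hence q r =
   e11 A w'^2 - 1 is even. *)
have ev : ((N.*2)%:Z %| N%:Z * q * r)%Z.
  have [k hk] : exists k, q * r = 2 * k.
    have [m2 hm2] : exists m2, M%:Z = 2 * m2.
      by case/dvdnP: NM => m2 ->; exists (m2 * N)%N%:Z; lia.
    have [l [hl|hl]] : exists l, w' = 2 * l \/ w' = 2 * l + 1.
      by exists (w' %/ 2)%Z; lia.
      by exfalso; move: ww'; rewrite hl hm2; lia.
    exists (N%:Z * s * w' * w' + 2 * l * l + 2 * l).
    have -> : q * r = e11 A * (w' * w') - 1 by rewrite hr addrC addKr.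
    by rewrite hs -addnn PoszD hl; ring.
  rewrite -mulrA hk -addnn PoszD; apply/dvdzP; exists k; ring.
clearbody C; rewrite (@char_eq_diag A (B * B * C)%g) //; last 3 first.
- apply/dvdzP.
  exists (e11 A * (2 * v * M%:Z - v * v * M%:Z * M%:Z * M%:Z)
     + v * M%:Z * e11 A * (w' * w') + (w + w') * e21 C).
  rewrite !eM /B !sl2_ofE C11 -hr.
  transitivity (e11 A - e11 A * ((w' * w) * (w' * w)) +
      (v * M%:Z * e11 A * (w' * w') + (w + w') * e21 C) * M%:Z); first by ring.
  by rewrite ww'; ring.
- apply: rpredB; first by rewrite hb dvdz_mulr.
  rewrite !eM /B !sl2_ofE C12 (_ : _ + _ =
    (w * w - v * M%:Z * M%:Z) * - (N%:Z * q * r) + M%:Z * (- (w + w') * e22 C)); last by ring.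
  by apply: rpredD; [rewrite dvdz_mull // rpredN | apply: dvdz_mulr].
- apply: rpredB; first by rewrite hc dvdz_mulr.
  rewrite !eM /B !sl2_ofE C21 (_ : _ + _ =
    (N%:Z * q * r) * (- r * (w' * w' - v * M%:Z * M%:Z)) + M%:Z * (v * (w + w') * e11 C)); last by ring.
  by apply: rpredD; [exact: dvdz_mulr | apply: dvdz_mulr].
- by rewrite !fM // ?fC ?addbb //; exact: GammaM.
- by do 2?apply: GammaM.
Qed.

(** [e11 A] is prime to [e12 A] by the determinant and to 2N by congruence. So adding some multiple
    of 2N [e12 A] makes it prime to [M], and a lower elementary matrix killed by [f] does this. *)
Lemma char_Gamma2 A : Gamma N.*2 A -> f A = false.
Proof.
move=> hA; have hNA : Gamma N A by apply: GammaS hA; rewrite -mul2n dvdn_mull.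
have [s [b [c [d [hs hb hc hd]]]]] := (Gamma_elt _ _).1 hA.
have cA : coprimez (e11 A) (e12 A * (N.*2)%:Z).
  rewrite coprimezMr; apply/andP; split; apply/coprimezP.
    by exists (e22 A, - e21 A); rewrite /= -(sl2_det A); ring.
  by exists (1, - s); rewrite /= hs; ring.
have [t ct] := coprimez_shift M0 cA.
have h2 : ((N.*2)%:Z %| t * (N.*2)%:Z)%Z by exact: dvdz_mull.
have gL := Gamma_lower h2.
have : f (A * lower (t * (N.*2)%:Z))%g = false.
  apply: char_Gamma2_unit; first exact: GammaM.
  by rewrite eM !lowerE mulr1 mulrCA.
by rewrite fM ?char_lower2 ?addbF //; apply: Gamma_lower; exact: dvdN2.
Qed.

End Char.
End CongruenceCharacters.

(** * Lifts and characters *)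

Section Lifts.
Local Open Scope classical_set_scope.
Local Open Scope group_scope.

Lemma opp1CA (A B : SL2Z) : A * (sl2_opp1 * B) = sl2_opp1 * (A * B).
Proof. by rewrite mulgA sl2_opp1C mulgA. Qed.

Lemma opp1KA (A : SL2Z) : sl2_opp1 * (sl2_opp1 * A) = A.
Proof. by rewrite mulgA sl2_opp1K mul1g. Qed.

Lemma opp1V (A : SL2Z) : (sl2_opp1 * A)^-1 = sl2_opp1 * A^-1.
Proof. by rewrite invgM sl2_opp1V sl2_opp1C. Qed.

Definition pm_Gamma (N : nat) : set SL2Z :=
  [set A | Gamma N A \/ Gamma N (sl2_opp1 * A)].

Definition char_lift (N : nat) (f : SL2Z -> bool) : set SL2Z :=
  [set A | (Gamma N A /\ f A = false)
        \/ (Gamma N (sl2_opp1 * A) /\ f (sl2_opp1 * A) = true)].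

(** Moves equality of images back to SL2(Z), where it becomes membership up to sign. *)
Lemma image_eqP (N : nat) (G : set SL2Z) : psl2_image G = psl2_image (Gamma N) <->
  (G `<=` pm_Gamma N) /\ (forall A, Gamma N A -> G A \/ G (sl2_opp1 * A)).
Proof.
split=> [/seteqP[h1 h2]|[h1 h2]].
  split=> A hA.
    have /h1[B hB /psl2_piP[e|e]] : psl2_image G (psl2_pi A) by exists A.
      by left; rewrite -e.
    by right; rewrite -e.
  have /h2[B hB /psl2_piP[e|e]] : psl2_image (Gamma N) (psl2_pi A) by exists A.
    by left; rewrite -e.
  by right; rewrite -e.
apply/seteqP; split=> _ [A hA <-].
  have [k|k] := h1 _ hA; first by exists A.
  by exists (sl2_opp1 * A) => //; apply/psl2_piP; right.
have [k|k] := h2 _ hA; first by exists A.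
by exists (sl2_opp1 * A) => //; apply/psl2_piP; right.
Qed.

Lemma pm_Gamma_lift N : is_lift (psl2_image (Gamma N)) (pm_Gamma N).
Proof.
split; last by apply/image_eqP; split=> // A hA; left; left.
split=> [|A B [hA|hA] [hB|hB]|A [hA|hA]].
- by left; exact: Gamma1.
- by left; exact: GammaM.
- by right; rewrite -opp1CA; exact: GammaM.
- by right; rewrite mulgA; exact: GammaM.
- by left; rewrite -[A * B]opp1KA -opp1CA mulgA; exact: GammaM.
- by left; exact: GammaV.
- by right; rewrite -opp1V; exact: GammaV.
Qed.

Lemma char_lift_lift N f : is_char N f -> is_lift (psl2_image (Gamma N)) (char_lift N f).
Proof.
move=> fM; split; last first.
  apply/image_eqP; split=> [A [[hA _]|[hA _]]|A hA]; [by left | by right |].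
  case fA: (f A); [right; right | by left; left].
  by rewrite opp1KA.
split=> [|A B [[hA fA]|[hA fA]] [[hB fB]|[hB fB]]|A [[hA fA]|[hA fA]]].
- by left; split; [exact: Gamma1 | exact: char1 fM].
- by left; rewrite fM ?fA ?fB //; split=> //; exact: GammaM.
- by right; rewrite -opp1CA fM ?fA ?fB //; split=> //; exact: GammaM.
- by right; rewrite mulgA fM ?fA ?fB //; split=> //; exact: GammaM.
- left; rewrite -[A * B]opp1KA -opp1CA mulgA fM ?fA ?fB //; split=> //.
  exact: GammaM.
- by left; rewrite (charV fM) //; split=> //; exact: GammaV.
- by right; rewrite -opp1V (charV fM) //; split=> //; exact: GammaV.
Qed.

Lemma lift_opp1 N G : is_lift (psl2_image (Gamma N)) G -> G sl2_opp1 -> G = pm_Gamma N.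
Proof.
move=> [[G1 GM GV] /image_eqP[h1 h2]] Gm; apply/seteqP; split=> // A [hA|hA].
  by have [//|k] := h2 _ hA; rewrite -[A]opp1KA; apply: GM.
by have [k|] := h2 _ hA; rewrite ?opp1KA // -[A]opp1KA; apply: GM.
Qed.

Lemma asboolN_false (P : Prop) : `[< ~ P >] = false <-> P.
Proof.
split=> [h|p]; last by apply/asboolP => /(_ p).
by apply: contrapT => /asboolP; rewrite h.
Qed.

(** Without -1, [G] contains exactly one of A and -A for each A in Gamma(N); the character records
    which. *)
Lemma lift_char N G : is_lift (psl2_image (Gamma N)) G -> ~ G sl2_opp1 ->
  is_char N (fun A => `[< ~ G A >]) /\ G = char_lift N (fun A => `[< ~ G A >]).
Proof.
move=> [[G1 GM GV] /image_eqP[h1 h2]] Gm.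
have excl A : G A -> G (sl2_opp1 * A) -> False.
  by move=> k1 k2; apply: Gm; rewrite -[sl2_opp1](mulgK A); apply: GM => //; exact: GV.
have fE A : Gamma N A -> ~ G A -> G (sl2_opp1 * A) by move=> /h2[].
split=> [A B hA hB|].
  have [kA|kA] := asboolP (~ G A); have [kB|kB] := asboolP (~ G B) => /=.
  - apply/asboolN_false; rewrite -[A * B]opp1KA -opp1CA mulgA.
    by apply: GM; exact: fE.
  - apply/asboolP => kAB; apply: (@excl (A * B)) => //; rewrite mulgA.
    by apply: GM; [exact: fE | exact: contrapT].
  - apply/asboolP => kAB; apply: (@excl (A * B)) => //; rewrite -opp1CA.
    by apply: GM; [exact: contrapT | exact: fE].
  - by apply/asboolN_false; apply: GM; exact: contrapT.
apply/seteqP; split=> A.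
  move=> kA; have [hA|hA] := h1 _ kA.
    by left; split=> //; apply/asboolN_false.
  by right; split=> //; apply/asboolP => k; exact: (excl A).
case=> [[hA /asboolN_false //]|[hA /asboolP k]].
by rewrite -[A]opp1KA; exact: fE.
Qed.

Lemma eq_char_lift N f g : (forall A, Gamma N A -> f A = g A) ->
  char_lift N f = char_lift N g.
Proof.
move=> fg; apply/seteqP; split=> A [[hA k]|[hA k]].
- by left; rewrite -fg.
- by right; rewrite -fg.
- by left; rewrite fg.
- by right; rewrite fg.
Qed.

(* When -1 lies in Gamma N, that is for N = 1 and N = 2, this is what keeps
   -1 out of char_lift N f. *)
Definition odd_at_opp1 (N : nat) (f : SL2Z -> bool) : Prop :=
  Gamma N sl2_opp1 -> f sl2_opp1 = true.

(** The second clause of [char_lift] would put -1 in Gamma(N); then oddness makes [f] differ on A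
    and -A, so that clause agrees with the first. *)
Lemma char_liftE N f A : is_char N f -> odd_at_opp1 N f -> Gamma N A ->
  char_lift N f A <-> f A = false.
Proof.
move=> fM fo hA; split=> [[[//]|[hA' k]]|]; last by left.
have hm : Gamma N sl2_opp1.
  by rewrite -[sl2_opp1](mulgK A); apply: GammaM => //; exact: GammaV.
by move: k; rewrite fM // fo //; case: (f A).
Qed.

Lemma char_lift_opp1 N f : is_char N f -> odd_at_opp1 N f -> ~ char_lift N f sl2_opp1.
Proof.
move=> fM fo [[h]|[]]; first by rewrite fo.
by rewrite sl2_opp1K (char1 fM).
Qed.

Lemma congruence_lift_Gamma2 N G : (0 < N)%N ->
  congruence_lift (psl2_image (Gamma N)) G -> Gamma N.*2 `<=` G.
Proof.
move=> N0 [Gl [_ [M [M0 GM]]]] A hA.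
have hNA : Gamma N A by apply: GammaS hA; rewrite -mul2n dvdn_mull.
have [Gm|Gm] := pselect (G sl2_opp1); first by rewrite (lift_opp1 Gl Gm); left.
have [fM _] := lift_char Gl Gm.
(* The level is deepened to a multiple of 2N, as [char_Gamma2] requires. *)
have M0' : (0 < M * N.*2)%N by rewrite muln_gt0 M0 double_gt0.
have fGM B : Gamma (M * N.*2) B -> `[< ~ G B >] = false.
  move=> hB; apply/asboolN_false; apply: GM.
  by apply: GammaS hB; exact: dvdn_mulr.
by apply/asboolN_false; exact: (char_Gamma2 fM M0' (dvdn_mull _ (dvdnn _)) fGM hA).
Qed.

(** Counting reduces to listing by [I] the characters of Gamma(N) / Gamma(2N) that are odd at -1
    when -1 lies in Gamma(N). The extra lift is the full preimage, indexed by [None]. *)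
Lemma card_congruence_lifts (N n : nat) (I : finType) (F : I -> SL2Z -> bool) :
    #|I|.+1 = n -> (0 < N)%N ->
    (forall i, is_char N (F i)) ->
    (forall i, odd_at_opp1 N (F i)) ->
    (forall i A, Gamma N.*2 A -> F i A = false) ->
    (forall i j, (forall A, Gamma N A -> F i A = F j A) -> i = j) ->
    (forall f, is_char N f -> odd_at_opp1 N f ->
       (forall A, Gamma N.*2 A -> f A = false) ->
       exists i, forall A, Gamma N A -> f A = F i A) ->
  ([set G : set SL2Z | congruence_lift (psl2_image (Gamma N)) G] #= `I_n)%card.
Proof.
move=> <- N0 Fc Fo F2 Finj Fsurj.
have N20 : (0 < N.*2)%N by rewrite double_gt0.
pose h (o : option I) : set SL2Z := if o is Some i then char_lift N (F i) else pm_Gamma N.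
have -> : [set G : set SL2Z | congruence_lift (psl2_image (Gamma N)) G] = h @` setT.
  apply/seteqP; split=> [G hG|_ [o _ <-]].
    have [Gl _] := hG.
    have [Gm|Gm] := pselect (G sl2_opp1).
      by exists None => //; rewrite /= (lift_opp1 Gl Gm).
    have [fM GE] := lift_char Gl Gm.
    have [||i hi] := Fsurj _ fM.
    - by move=> _; apply/asboolP.
    - move=> A hA; apply/asboolN_false.
      exact: (congruence_lift_Gamma2 N0 hG hA).
    by exists (Some i) => //=; rewrite GE; apply: eq_char_lift => A /hi.
  have G2 : Gamma N.*2 `<=` Gamma N by apply: GammaS; rewrite -mul2n dvdn_mull.
  case: o => [i|] /=.
    have hl := char_lift_lift (Fc i).
    split=> //; split; first by case: hl.
    by exists N.*2; split=> // A hA; left; split; [exact: G2 | exact: F2].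
  have hl := pm_Gamma_lift N.
  split=> //; split; first by case: hl.
  by exists N.*2; split=> // A hA; left; exact: G2.
have hinj : injective h.
  have nN i : char_lift N (F i) <> pm_Gamma N.
    move=> e; apply: (char_lift_opp1 (Fc i) (Fo i)); rewrite e.
    by right; rewrite sl2_opp1K; exact: Gamma1.
  case=> [i|] [j|] //= e.
  - congr Some; apply: Finj => A hA.
    have := char_liftE (Fc i) (Fo i) hA; rewrite e (char_liftE (Fc j) (Fo j) hA).
    by case: (F i A) (F j A) => [] [] // [k1 k2]; rewrite (k1, k2).
  - by case: (nN i).
  - by case: (nN j).
apply: card_eq_trans (inj_card_eq (in2W hinj)) _; rewrite card_eq_sym.
pose r (o : option I) : nat := enum_rank o.
have -> : `I_(#|I|.+1) = r @` setT.
  rewrite -card_option; apply/seteqP; split=> [k /= hk|_ [o _ <-]]; last exact: ltn_ord.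
  by exists (enum_val (Ordinal hk)) => //; rewrite /r enum_valK.
by apply: inj_card_eq => o o' _ _ /val_inj/enum_rank_inj.
Qed.

End Lifts.

(** * Characters of Gamma(N) / Gamma(2N) *)

Section LevelTwoCharacters.
Local Open Scope ring_scope.

Definition oddz (x : int) : bool := odd `|x|%N.

Lemma oddzD x y : oddz (x + y) = oddz x (+) oddz y.
Proof. rewrite /oddz; lia. Qed.

Lemma oddzN x : oddz (- x) = oddz x.
Proof. by rewrite /oddz abszN. Qed.

Lemma oddzM x y : oddz (x * y) = oddz x && oddz y.
Proof. by rewrite /oddz abszM oddM. Qed.

Definition oddzE := (oddzD, oddzN, oddzM).

Lemma oddz_dvd (N : nat) (x : int) : oddz x = false -> (N.*2%:Z %| N%:Z * x)%Z.
Proof.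
move=> hx; have -> : x = 2 * (x %/ 2)%Z by move: hx; rewrite /oddz; lia.
by rewrite mulrA (mulrC _ 2) dvdz_mulr // dvdzE /= -mul2n.
Qed.

Lemma oddz_Gamma2 A : Gamma 2 A ->
  ((oddz (e11 A) = true) * (oddz (e12 A) = false) * (oddz (e21 A) = false)
   * (oddz (e22 A) = true))%type.
Proof.
by move=> /Gamma_elt[x [y [z [t [-> -> -> ->]]]]]; rewrite !oddzE.
Qed.

(** Gamma(N) and Gamma(2) meet in Gamma(2N), since for odd N the product N x is even only if x
    is. *)
Lemma Gamma2_oddN (N : nat) A : odd N -> Gamma N A ->
  oddz (e11 A) -> ~~ oddz (e12 A) -> ~~ oddz (e21 A) -> oddz (e22 A) -> Gamma N.*2 A.
Proof.
move=> oN /Gamma_elt[x [y [z [t [h1 h2 h3 h4]]]]].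
have oNz : oddz N%:Z = true by [].
rewrite h1 h2 h3 h4 !oddzE oNz /= => k1 k2 k3 k4.
apply/GammaP; rewrite h1 h2 h3 h4 !(addrC 1) !addrK.
by split; apply: oddz_dvd; apply: negbTE => //; move: k1 k4; rewrite !addTb.
Qed.

(** * Odd level: the sign character of S_3 *)

Section OddLevel.
Variable N : nat.
Hypothesis oN : odd N.

(* The signature of SL2(F_2) = S_3, which is even exactly on the identity and
   on the two elements of trace 1. *)
Definition sgn2 (A : SL2Z) : bool :=
  ~~ (oddz (e11 A) (+) oddz (e22 A)) && (oddz (e12 A) || oddz (e21 A)).

Lemma sgn2_char : is_char N sgn2.
Proof.
move=> A B _ _; rewrite /sgn2 !eM !oddzE.
have := congr1 oddz (sl2_det A); have := congr1 oddz (sl2_det B).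
rewrite !oddzE.
case: (oddz (e11 A)); case: (oddz (e12 A)); case: (oddz (e21 A)); case: (oddz (e22 A)) => //=;
case: (oddz (e11 B)); case: (oddz (e12 B)); case: (oddz (e21 B)); case: (oddz (e22 B)) => //=.
Qed.

Lemma char_eq_mod2 f A B : is_char N f -> (forall C, Gamma N.*2 C -> f C = false) ->
    Gamma N A -> Gamma N B ->
    oddz (e11 A) = oddz (e11 B) -> oddz (e12 A) = oddz (e12 B) ->
    oddz (e21 A) = oddz (e21 B) -> oddz (e22 A) = oddz (e22 B) -> f A = f B.
Proof.
move=> fM f2 hA hB h11 h12 h21 h22; apply: (char_div fM) => //; apply: f2.
have := congr1 oddz (sl2_det B); rewrite !oddzE => dB.
apply: Gamma2_oddN => //; first by apply: GammaM => //; exact: GammaV.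
all: rewrite !eM !eV !oddzE ?h11 ?h12 ?h21 ?h22; move: dB;
case: (oddz (e11 B)); case: (oddz (e12 B)); case: (oddz (e21 B)); case: (oddz (e22 B)) => //=.
Qed.

(** Modulo 2, [U] and [L] are two transpositions generating S_3. The braid relation ULU = LUL forces
    f U = f L, and each of the six residue classes is a word in [U] and [L]. *)
Lemma odd_char_sgn2 f A : is_char N f -> (forall C, Gamma N.*2 C -> f C = false) ->
  Gamma N A -> f A = f (upper N%:Z) && sgn2 A.
Proof.
move=> fM f2 hA; pose U := upper N%:Z; pose L := lower N%:Z.
have gU : Gamma N U by exact: Gamma_upper.
have gL : Gamma N L by exact: Gamma_lower.
have oNz : oddz N%:Z = true by [].
have oU : ((oddz (e11 U) = true) * (oddz (e12 U) = true) * (oddz (e21 U) = false)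
   * (oddz (e22 U) = true))%type by rewrite !upperE.
have oL : ((oddz (e11 L) = true) * (oddz (e12 L) = false) * (oddz (e21 L) = true)
   * (oddz (e22 L) = true))%type by rewrite !lowerE.
have gUL := GammaM gU gL; have gLU := GammaM gL gU.
have gULU := GammaM gUL gU; have gLUL := GammaM gLU gL.
have UL : f L = f U.
  have : f (U * L * U)%g = f (L * U * L)%g.
    by apply: char_eq_mod2; rewrite // !eM !oddzE !oU !oL.
  by rewrite !fM //; case: (f U); case: (f L).
have := congr1 oddz (sl2_det A); rewrite !oddzE /sgn2.
have key B : Gamma N B -> oddz (e11 A) = oddz (e11 B) -> oddz (e12 A) = oddz (e12 B) ->
    oddz (e21 A) = oddz (e21 B) -> oddz (e22 A) = oddz (e22 B) -> f A = f B.
  by move=> hB *; apply: char_eq_mod2.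
case h11: (oddz (e11 A)); case h12: (oddz (e12 A)); case h21: (oddz (e21 A));
  case h22: (oddz (e22 A)) => //= _; rewrite ?andbT ?andbF.
- by rewrite (key (L * U)%g) ?fM ?UL ?addbb // ?h11 ?h12 ?h21 ?h22 !eM !oddzE !oU !oL.
- by rewrite (key U) ?h11 ?h12 ?h21 ?h22 ?oU.
- by rewrite (key L) ?UL ?h11 ?h12 ?h21 ?h22 ?oL.
- by rewrite (key 1%g) ?(char1 fM) ?e1 ?h11 ?h12 ?h21 ?h22 //; exact: Gamma1.
- by rewrite (key (U * L)%g) ?fM ?UL ?addbb // ?h11 ?h12 ?h21 ?h22 !eM !oddzE !oU !oL.
- by rewrite (key (U * L * U)%g) ?fM ?UL ?addbb // ?h11 ?h12 ?h21 ?h22 !eM !oddzE !oU !oL.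
Qed.

End OddLevel.

(** * Even level: linear forms on (Z/2)^3 *)

Section EvenLevel.
Variable N : nat.
Hypothesis N0 : (0 < N)%N.
Hypothesis eN : ~~ odd N.

(** For A = 1 + N X these are entries of X modulo 2; the fourth is redundant because the trace of X
    is even. *)
Definition c11 (A : SL2Z) : bool := oddz ((e11 A - 1) %/ N%:Z)%Z.
Definition c12 (A : SL2Z) : bool := oddz (e12 A %/ N%:Z)%Z.
Definition c21 (A : SL2Z) : bool := oddz (e21 A %/ N%:Z)%Z.

Lemma coordE A x y z : e11 A = 1 + N%:Z * x -> e12 A = N%:Z * y -> e21 A = N%:Z * z ->
  ((c11 A = oddz x) * (c12 A = oddz y) * (c21 A = oddz z))%type.
Proof.
have nN : N%:Z != 0 by rewrite eqz_nat -lt0n.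
move=> h1 h2 h3; rewrite /c11 /c12 /c21 h1 h2 h3 (addrC 1) addrK.
by rewrite !(mulrC N%:Z) !mulzK.
Qed.

Lemma oddzNM x : oddz (N%:Z * x) = false.
Proof. by rewrite oddzM [oddz N%:Z](negbTE eN). Qed.

(** (1 + N X)(1 + N Y) = 1 + N (X + Y + N X Y), and N is even. *)
Lemma coord_char : is_char N c11 /\ is_char N c12 /\ is_char N c21.
Proof.
suff h A B : Gamma N A -> Gamma N B ->
  [/\ c11 (A * B)%g = c11 A (+) c11 B, c12 (A * B)%g = c12 A (+) c12 B
    & c21 (A * B)%g = c21 A (+) c21 B].
  by split; [|split] => A B hA hB; case: (h A B hA hB).
move=> /Gamma_elt[x [y [z [t [h1 h2 h3 h4]]]]] /Gamma_elt[x' [y' [z' [t' [k1 k2 k3 k4]]]]].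
rewrite !(coordE h1 h2 h3) !(coordE k1 k2 k3).
have m1 : e11 (A * B)%g = 1 + N%:Z * (x + x' + N%:Z * (x * x' + y * z')).
  by rewrite eM h1 h2 k1 k3; ring.
have m2 : e12 (A * B)%g = N%:Z * (y + y' + N%:Z * (x * y' + y * t')).
  by rewrite eM h1 h2 k2 k4; ring.
have m3 : e21 (A * B)%g = N%:Z * (z + z' + N%:Z * (z * x' + t * z')).
  by rewrite eM h3 h4 k1 k3; ring.
by rewrite !(coordE m1 m2 m3) !oddzD !oddzNM !addbF.
Qed.

Definition lin_char (a b c : bool) (A : SL2Z) : bool :=
  (a && c12 A) (+) (b && c21 A) (+) (c && c11 A).

Lemma lin_char_char a b c : is_char N (lin_char a b c).
Proof.
move=> A B hA hB; have [h1 [h2 h3]] := coord_char.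
rewrite /lin_char h1 // h2 // h3 //.
by case: a b c (c12 A) (c12 B) (c21 A) (c21 B) (c11 A) (c11 B)
  => [] [] [] [] [] [] [] [] [].
Qed.

Lemma coord_Gamma2 A : Gamma N.*2 A -> ((c11 A = false) * (c12 A = false) * (c21 A = false))%type.
Proof.
move=> /Gamma_elt[x [y [z [t [h1 h2 h3 _]]]]].
have E u : N.*2%:Z * u = N%:Z * (2 * u) :> int by rewrite -addnn PoszD; ring.
rewrite E in h1; rewrite E in h2; rewrite E in h3.
by rewrite !(coordE h1 h2 h3) !oddzM.
Qed.

Lemma lin_char_Gamma2 a b c A : Gamma N.*2 A -> lin_char a b c A = false.
Proof. by move=> /coord_Gamma2 h; rewrite /lin_char !h !andbF. Qed.

(** With A = 1 + N X, the determinant condition reads tr X = - N det X, so the last entry of X has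
    the parity of the first. *)
Lemma Gamma2_coord A : Gamma N A -> c11 A = false -> c12 A = false -> c21 A = false ->
  Gamma N.*2 A.
Proof.
move=> /Gamma_elt[x [y [z [t [h1 h2 h3 h4]]]]]; rewrite !(coordE h1 h2 h3) => k1 k2 k3.
have k4 : oddz t = false.
  have nN : N%:Z != 0 by rewrite eqz_nat -lt0n.
  have : N%:Z * (x + t + N%:Z * (x * t - y * z)) = 0.
    have d := sl2_det A; rewrite h1 h2 h3 h4 in d.
    by rewrite -[RHS](subrr 1) -[X in _ = X - 1]d; ring.
  move=> /eqP; rewrite mulf_eq0 (negbTE nN) /= => /eqP/(congr1 oddz).
  by rewrite !oddzD oddzNM k1 addbF.
apply/GammaP; rewrite h1 h2 h3 h4 !(addrC 1) !addrK.
by split; exact: oddz_dvd.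
Qed.

Lemma tri_det : (1 + N%:Z) * (1 - N%:Z) - N%:Z * (- N%:Z) = 1.
Proof. ring. Qed.

(** Completes [upper N] and [lower N], for which [c11] vanishes, to a basis of Gamma(N) / Gamma(2N).
    The off-diagonal entries restore the determinant of the diagonal (1 + N, 1 - N). *)
Definition tri : SL2Z := sl2_of tri_det.

Lemma Gamma_tri : Gamma N tri.
Proof.
by apply/Gamma_elt; exists 1, 1, (-1), (-1); rewrite !sl2_ofE; split; ring.
Qed.

Lemma coord_tri : ((c11 tri = true) * (c12 tri = true) * (c21 tri = true))%type.
Proof. by rewrite !(@coordE tri 1 1 (-1)) // !sl2_ofE; ring. Qed.

Lemma coord_upper :
  ((c11 (upper N%:Z) = false) * (c12 (upper N%:Z) = true) * (c21 (upper N%:Z) = false))%type.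
Proof. by rewrite !(@coordE _ 0 1 0) // !upperE; ring. Qed.

Lemma coord_lower :
  ((c11 (lower N%:Z) = false) * (c12 (lower N%:Z) = false) * (c21 (lower N%:Z) = true))%type.
Proof. by rewrite !(@coordE _ 0 0 1) // !lowerE; ring. Qed.

Lemma lin_charE a b c : ((lin_char a b c (upper N%:Z) = a) * (lin_char a b c (lower N%:Z) = b)
  * (lin_char a b c tri = a (+) b (+) c))%type.
Proof.
by rewrite /lin_char !coord_upper !coord_lower !coord_tri !andbT !andbF !addbF !addFb.
Qed.

Lemma lin_char_inj a b c a' b' c' :
  (forall A, Gamma N A -> lin_char a b c A = lin_char a' b' c' A) -> (a, b, c) = (a', b', c').
Proof.
move=> h; have := h _ (Gamma_upper (dvdzz N%:Z)); have := h _ (Gamma_lower (dvdzz N%:Z)).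
have := h _ Gamma_tri; rewrite !lin_charE => h3 h2 h1; move: h3; rewrite h1 h2.
by case: a' b' c c' {h h1 h2} => [] [] [] [].
Qed.

Lemma even_char_lin f : is_char N f -> (forall C, Gamma N.*2 C -> f C = false) ->
  exists a b c, forall A, Gamma N A -> f A = lin_char a b c A.
Proof.
move=> fM f2; pose U := upper N%:Z; pose L := lower N%:Z.
have gU : Gamma N U by exact: Gamma_upper.
have gL : Gamma N L by exact: Gamma_lower.
have gT := Gamma_tri.
(* All three coordinates of [tri] are 1, so its value is the sum of the three coefficients; this
   gives the last one. *)
exists (f U), (f L), (f U (+) f L (+) f tri) => A hA.
set g := lin_char _ _ _.
have gM : is_char N g by exact: lin_char_char.
have g2 C : Gamma N.*2 C -> g C = false by exact: lin_char_Gamma2.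
have fg : [/\ f U = g U, f L = g L & f tri = g tri].
  by rewrite /g !lin_charE; split=> //; case: (f U) (f L) (f tri) => [] [] [].
(* The product of basis elements with the coordinates of [A]; [tri] also shifts [c12] and [c21],
   whence the corrections by [c11 A]. *)
pose P := ((if c12 A (+) c11 A then U else 1) * (if c21 A (+) c11 A then L else 1)
   * (if c11 A then tri else 1))%g.
have gP : Gamma N P.
  by apply: GammaM; [apply: GammaM|]; case: ifP => // _; exact: Gamma1.
have PE phi : is_char N phi -> phi P = ((c12 A (+) c11 A) && phi U)
    (+) ((c21 A (+) c11 A) && phi L) (+) (c11 A && phi tri).
  move=> pM; have p1 := char1 pM.
  have if1 b X : phi (if b then X else 1%g) = b && phi X by case: b.
  by rewrite !pM ?if1 //; try (case: ifP => // _; exact: Gamma1); apply: GammaM;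
     case: ifP => // _; exact: Gamma1.
have hAP : Gamma N.*2 (A * P^-1)%g.
  have [h1 [h2 h3]] := coord_char; have gP' := GammaV gP.
  have cP : [/\ c11 P = c11 A, c12 P = c12 A & c21 P = c21 A].
    rewrite !PE // !coord_upper !coord_lower !coord_tri.
    by case: (c11 A); case: (c12 A); case: (c21 A).
  case: cP => p1 p2 p3.
  apply: Gamma2_coord; first exact: GammaM.
  - by rewrite h1 // (charV h1) // p1 addbb.
  - by rewrite h2 // (charV h2) // p2 addbb.
  - by rewrite h3 // (charV h3) // p3 addbb.
rewrite (char_div fM hA gP (f2 _ hAP)) (char_div gM hA gP (g2 _ hAP)).
by case: fg => gU' gL' gT'; rewrite !PE // gU' gL' gT'.
Qed.

End EvenLevel.
End LevelTwoCharacters.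

(** * A noncongruence character *)

Section SidesOfAnEdge.
Local Open Scope ring_scope.

Lemma rot_det : 0 * 0 - 1 * (-1) = 1 :> int. Proof. by []. Qed.
Definition rot : SL2Z := sl2_of rot_det.

Lemma rotE : ((e11 rot = 0) * (e12 rot = 1) * (e21 rot = -1) * (e22 rot = 0))%type.
Proof. by rewrite /rot !sl2_ofE. Qed.

Lemma rot_sqr : (rot * rot)%g = sl2_opp1.
Proof. by apply: sl2_ext; rewrite !eM !rotE !eN1; ring. Qed.

Lemma mulz_eq1 (a d : int) : a * d = 1 -> (a = 1 /\ d = 1) \/ (a = -1 /\ d = -1).
Proof.
move=> h; have : absz (a * d) = 1%N by rewrite h.
rewrite abszM => /eqP; rewrite muln_eq1 => /andP[/eqP ha /eqP hd].
by move: h ha hd; lia.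
Qed.

(** Euclid's algorithm on the bottom row: right multiplication by [upper (- k) * rot] replaces [e21]
    by minus the remainder of [e22] by [e21]. *)
Lemma sl2_gen (P : SL2Z -> Prop) :
    (forall A B, P A -> P B -> P (A * B)%g) -> (forall A, P A -> P A^-1%g) ->
    P (upper (-1)) -> P rot -> forall A, P A.
Proof.
move=> PM PV Pu Pr.
have P1 : P 1%g by rewrite -(mulgV rot); apply: PM => //; exact: PV.
have Pn (n : nat) : P (upper (- n%:Z)).
  elim: n => [|n IH]; first by rewrite (_ : upper _ = 1%g) //; apply: sl2_ext; rewrite !upperE !e1.
  by rewrite -addn1 PoszD opprD upperD; apply: PM.
have Pz (n : int) : P (upper n).
  have [h|h] : n = - `|n|%N%:Z \/ n = `|n|%N%:Z by lia.
    by rewrite h.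
  rewrite h (_ : upper _ = (upper (- `|n|%N%:Z))^-1%g); first exact: PV.
  by apply: sl2_ext; rewrite !eV !upperE ?opprK ?oppr0.
have Pm : P sl2_opp1 by rewrite -rot_sqr; apply: PM.
move=> A; have [m] := ubnP `|e21 A|%N; elim: m A => // m IH A hm.
have [c0|c0] := eqVneq (e21 A) 0.
  have := sl2_det A; rewrite c0 mulr0 subr0 => /mulz_eq1[[ha hd]|[ha hd]].
    by rewrite (_ : A = upper (e12 A)) //; apply: sl2_ext; rewrite !upperE.
  rewrite (_ : A = (sl2_opp1 * upper (- e12 A))%g); first exact: PM.
  by apply: sl2_ext; rewrite eM !eN1 !upperE; lia.
pose k := (e22 A %/ e21 A)%Z.
rewrite -(mulgK (upper (- k) * rot)%g A); apply: (PM); last by apply: (PV); exact: PM.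
apply: IH; rewrite mulgA eM !rotE mulr0 add0r mulrN1 eM !upperE abszN.
have := divz_eq (e22 A) (e21 A); have := ltz_mod (e22 A) c0; have := modz_ge0 (e22 A) c0.
rewrite -/k => h1 h2 h3.
rewrite (_ : _ + _ = (e22 A %% e21 A)%Z); last by rewrite [X in _ + X * 1]h3; ring.
lia.
Qed.

(* With z = exp (i pi / 3), the sign of wall g is that of the real part of
   g z, that is, the side of the Farey edge (0, oo) on which g z lies. *)
Definition wall (g : SL2Z) : int :=
  2 * (e11 g * e21 g + e12 g * e22 g) + (e11 g * e22 g + e12 g * e21 g).

(** [wall g] is odd, hence never 0: no translate of z lies on the edge. *)
Definition side (g : SL2Z) : bool := 0 < wall g.

(** The equations ac = 0 and bd = 0 say that the images of oo and 0 are again in {0, oo}; this is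
    the stabiliser of the edge. *)
Lemma edge_stab (a b c d : int) : a * d - b * c = 1 -> a * c = 0 -> b * d = 0 ->
  [\/ [/\ a = 1, b = 0, c = 0 & d = 1], [/\ a = -1, b = 0, c = 0 & d = -1],
      [/\ a = 0, b = 1, c = -1 & d = 0] | [/\ a = 0, b = -1, c = 1 & d = 0]].
Proof.
move=> h /eqP; rewrite mulf_eq0 => /orP[/eqP k|/eqP k] /eqP; rewrite mulf_eq0 => /orP[/eqP l|/eqP l].
- by move: h; rewrite k l !mul0r.
- have /mulz_eq1[[hb hc]|[hb hc]] : b * (- c) = 1 by rewrite -h k; ring.
    by constructor 3; split=> //; lia.
  by constructor 4; split=> //; lia.
- have /mulz_eq1[[ha hd]|[ha hd]] : a * d = 1 by rewrite -h k; ring.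
    by constructor 1.
  by constructor 2.
- by move: h; rewrite k l !mulr0.
Qed.

(** With x = ac, y = bd and Y = ad + bc, a sign change gives 4 (x + y)^2 <= Y^2 = 1 + 4xy. Hence x^2
    + xy + y^2 <= 1/4, which forces x = y = 0 for integers. *)
Lemma wall_flip (a b c d : int) : a * d - b * c = 1 ->
    (0 < 2 * (a * c + b * d) + (a * d + b * c))
      != (0 < 2 * (a * c + b * d) - (a * d + b * c)) ->
  a * c = 0 /\ b * d = 0.
Proof.
move=> h hs; set x := a * c in hs *; set y := b * d in hs *.
set Y := a * d + b * c in hs.
have YY : Y * Y = 1 + 4 * (x * y).
  rewrite /Y /x /y; transitivity ((a * d - b * c) * (a * d - b * c) + 4 * (a * c * (b * d))).
    by ring.
  by rewrite h mulr1.
have XY : (2 * (x + y)) * (2 * (x + y)) <= Y * Y.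
  suff : (2 * (x + y) + Y) * (2 * (x + y) - Y) <= 0 by lia.
  move: hs; set p := _ + Y; set q := _ - Y.
  case: (ltrP 0 p) => h1; case: (ltrP 0 q) => h2 // _.
    exact: mulr_ge0_le0 (ltW h1) h2.
  exact: mulr_le0_ge0 h1 (ltW h2).
rewrite YY in XY.
have : x ^+ 2 + (y ^+ 2 + (x + y) ^+ 2) <= 0 by lia.
have hx := sqr_ge0 x; have hy := sqr_ge0 y; have hxy := sqr_ge0 (x + y) => k.
by split; apply/eqP; rewrite -sqrf_eq0; apply/eqP; lia.
Qed.

(** The hypothesis on [wall] suits both generators [upper (-1)] and [rot]: they send z = exp (i pi /
    3) to the same point, z - 1 = -1/z, whose real part is that of z negated. *)
Lemma side_flip (g x : SL2Z) :
    wall (g * x)%g = 2 * (e11 g * e21 g + e12 g * e22 g)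
                     - (e11 g * e22 g + e12 g * e21 g) ->
    side g (+) side (g * x)%g ->
  [\/ g = 1%g, g = sl2_opp1, g = rot | g = (sl2_opp1 * rot)%g].
Proof.
rewrite /side => ->; rewrite /wall => hs.
have dg := sl2_det g.
have [|hx hy] := wall_flip dg; first by move: hs; case: ltP; case: ltP.
case: (edge_stab dg hx hy) => -[h1 h2 h3 h4].
- by constructor 1; apply: sl2_ext; rewrite !e1.
- by constructor 2; apply: sl2_ext; rewrite !eN1.
- by constructor 3; apply: sl2_ext; rewrite !rotE.
- by constructor 4; apply: sl2_ext; rewrite !eM !rotE !eN1; lia.
Qed.

Lemma side_flip_upper g : side g (+) side (g * upper (-1))%g ->
  [\/ g = 1%g, g = sl2_opp1, g = rot | g = (sl2_opp1 * rot)%g].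
Proof. by apply: side_flip; rewrite /wall !eM !upperE; ring. Qed.

Lemma side_flip_rot g : side g (+) side (g * rot)%g ->
  [\/ g = 1%g, g = sl2_opp1, g = rot | g = (sl2_opp1 * rot)%g].
Proof. by apply: side_flip; rewrite /wall !eM !rotE; ring. Qed.

End SidesOfAnEdge.

(** * Parity of the number of edges crossed *)

Section NoncongruenceCharacter.
Local Open Scope classical_set_scope.

(** Says that the edge g^-1 (0, oo) separates z from x z. *)
Definition crossed (x g : SL2Z) : bool := side g (+) side (g * x)%g.

Lemma crossedM x y g : crossed (x * y)%g g = crossed x g (+) crossed y (g * x)%g.
Proof. by rewrite /crossed mulgA; case: (side (g * x)%g); case: (side g); case: (side _). Qed.

(** Each generator has at most four crossings, and [crossedM] carries finiteness to products. Over
    an infinite support the big sum would default to [false]. *)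
Lemma finite_crossed x : finite_set [set g | crossed x g].
Proof.
pose E : set SL2Z := [set 1%g; sl2_opp1; rot; (sl2_opp1 * rot)%g].
have fE : finite_set E by exact: finite_set4.
have fin_preim x' (X : set SL2Z) : finite_set X -> finite_set [set g | X (g * x')%g].
  move=> fX; apply: sub_finite_set (finite_image (fun g => (g * x'^-1)%g) fX).
  by move=> g /= Xg; exists (g * x')%g => //; rewrite mulgK.
move: x; apply: sl2_gen.
- move=> x y fx fy.
  apply: (@sub_finite_set _ _ ([set g | crossed x g] `|` [set g | crossed y (g * x)%g])).
    move=> g /=; rewrite crossedM; case: (crossed x g); first by left.
    by right.
  by rewrite finite_setU; split=> //; exact: (fin_preim x _ fy).
- move=> x fx; apply: sub_finite_set (fin_preim x^-1%g _ fx).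
  by move=> g /=; rewrite /crossed mulgVK addbC.
- by apply: sub_finite_set fE => g /side_flip_upper[] ->; rewrite /E /=; tauto.
- by apply: sub_finite_set fE => g /side_flip_rot[] ->; rewrite /E /=; tauto.
Qed.

(** Both sums are restricted to the union of the supports, a finite set on which [fsbig_split]
    applies. *)
Lemma fsbig_addb (T : choiceType) (P : set T) (f g : T -> bool) :
    finite_set [set x | f x] -> finite_set [set x | g x] ->
  \big[addb/false]_(x \in P) (f x (+) g x) =
  (\big[addb/false]_(x \in P) f x) (+) (\big[addb/false]_(x \in P) g x).
Proof.
move=> ff fg; pose Q := P `&` ([set x | f x] `|` [set x | g x]).
have fQ : finite_set Q by apply: finite_setIr; rewrite finite_setU.
have QP : Q `<=` P by move=> x [].
have Qw (h : T -> bool) : (forall x, h x -> f x \/ g x) ->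
    \big[addb/false]_(x \in P) h x = \big[addb/false]_(x \in Q) h x.
  move=> hh; rewrite (fsbig_widen Q P) // => x [Px nQ] /=.
  by apply/negP => /hh k; apply: nQ; split.
rewrite !Qw ?fsbig_split //; try by [move=> x ->; left | move=> x ->; right].
by move=> x; case: (f x); [left | right].
Qed.

Definition crossing_parity (N : nat) (x : SL2Z) : bool :=
  \big[addb/false]_(g \in Gamma N) crossed x g.

Lemma crossing_parityM N x y : crossing_parity N (x * y)%g =
  crossing_parity N x (+) \big[addb/false]_(g \in Gamma N) crossed y (g * x)%g.
Proof.
rewrite /crossing_parity -fsbig_addb.
- by apply: eq_fsbigr => g _; rewrite crossedM.
- exact: finite_crossed.
- apply: sub_finite_set (finite_image (fun g => (g * x^-1)%g) (finite_crossed y)).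
  by move=> g /= Xg; exists (g * x)%g => //; rewrite mulgK.
Qed.

(** Right translation by [x] permutes Gamma(N). Leaving [y] arbitrary allows a base point moved by
    an element outside Gamma(N). *)
Lemma crossing_parity_Gamma N x y : Gamma N x ->
  crossing_parity N (x * y)%g = crossing_parity N x (+) crossing_parity N y.
Proof.
move=> hx; rewrite crossing_parityM; congr (_ (+) _).
rewrite /crossing_parity [RHS](reindex_fsbig (fun g => g * x)%g (Gamma N)) //.
split=> [g hg|g g' _ _|g hg]; [exact: GammaM | exact: mulIg |].
by exists (g * x^-1)%g; [apply: GammaM => //; exact: GammaV | rewrite mulgVK].
Qed.

Lemma crossing_parity_step N x : (forall g, Gamma N g -> ~~ crossed (upper (-1)) (g * x)%g) ->
  crossing_parity N (x * upper (-1))%g = crossing_parity N x.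
Proof.
move=> h; rewrite crossing_parityM fsbig1 ?addbF // => g hg.
by apply: negbTE; exact: h.
Qed.

Local Open Scope ring_scope.

Lemma crossed_upper g : crossed (upper (-1)) g ->
  (e11 g = 0) \/ [/\ e12 g = 0 & e21 g = 0].
Proof.
by move=> /side_flip_upper[] ->; rewrite ?eM ?rotE ?eN1 ?e1; [right|right|left|left].
Qed.

Lemma noncongruence_char N : (2 < N)%N ->
  exists f, is_char N f /\ exists2 A, Gamma N.*2 A & f A = true.
Proof.
move=> N2; exists (crossing_parity N); split.
  by move=> A B hA _; exact: crossing_parity_Gamma.
have ndvd (k : nat) : (0 < k < N)%N -> ~~ (N%:Z %| k%:Z)%Z.
  by move=> /andP[k0 kN]; rewrite dvdzE /= gtnNdvd.
have c1 : crossing_parity N 1%g = false.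
  by rewrite /crossing_parity fsbig1 // => g _; rewrite /crossed mulg1 addbb.
(* Of the four possible crossings -1 and the two signs of [rot] are not in Gamma(N), as N > 2; only
   g = 1 counts. *)
have cV : crossing_parity N (upper (-1)) = true.
  rewrite /crossing_parity -(fsbig_widen [set 1%g] (Gamma N)).
  - by rewrite fsbig_set1 /crossed mul1g /side /wall !e1 !upperE.
  - by move=> _ ->; exact: Gamma1.
  move=> g [/Gamma_elt[x [y [z [t [h1 h2 h3 h4]]]]] g1] /=; apply/negP => /side_flip_upper.
  case=> ge; first exact: g1.
  - move: h1; rewrite ge eN1 => h1; apply: (negP (ndvd 2%N N2)).
    by apply/dvdzP; exists (- x); lia.
  - move: h1; rewrite ge rotE => h1; apply: (negP (ndvd 1%N (ltnW N2))).
    by apply/dvdzP; exists (- x); lia.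
  - move: h1; rewrite ge eM !eN1 !rotE => h1; apply: (negP (ndvd 1%N (ltnW N2))).
    by apply/dvdzP; exists (- x); lia.
(* Going on from z - 1 to z - N crosses nothing more: a crossing would make N divide 1 or some
   integer strictly between 0 and N. *)
have cVk k : (k < N)%N -> crossing_parity N (upper (- (k.+1)%:Z)) = true.
  elim: k => // k IH kN; rewrite -addn1 PoszD opprD upperD crossing_parity_step ?IH //; first exact: ltnW.
  move=> g /Gamma_elt[x [y [z [t [h1 h2 h3 h4]]]]]; apply/negP => /crossed_upper.
  rewrite !eM !upperE h1 h2 h3; case=> [h|[h _]].
    by apply: (negP (ndvd 1%N (ltnW N2))); apply/dvdzP; exists (- x); lia.
  by apply: (negP (ndvd k.+1 kN)); apply/dvdzP; exists (y - x * (k.+1)%:Z); lia.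
(* No edge in the orbit ends at the cusp 1/2 = [L] oo, since N divides neither 1 nor 2. The entry 2
   is even so that the conjugate [eta] of V^N by [L] agrees with V^N modulo 2N. *)
pose L := lower 2.
have cLk k : crossing_parity N (L * upper (- k%:Z))%g = crossing_parity N L.
  elim: k => [|k IH].
    by congr (crossing_parity N _); apply: sl2_ext; rewrite !eM !upperE; ring.
  rewrite -addn1 PoszD opprD upperD mulgA crossing_parity_step //.
  move=> g /Gamma_elt[x [y [z [t [h1 h2 h3 h4]]]]]; apply/negP => /crossed_upper.
  rewrite !eM !upperE !lowerE h1 h2 h3 h4; case=> [h|[_ h]].
    by apply: (negP (ndvd 1%N (ltnW N2))); apply/dvdzP; exists (- (x + 2 * y)); lia.
  by apply: (negP (ndvd 2%N N2)); apply/dvdzP; exists (- (z + 2 * t)); lia.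
pose eta := (L * upper (- N%:Z) * L^-1)%g.
have gu : Gamma N (upper (- N%:Z)) by apply: Gamma_upper; rewrite rpredN.
have geta : Gamma N eta.
  apply/Gamma_elt; exists 2, (-1), 4, (-2).
  by rewrite /eta !eM !eV !upperE !lowerE; split; ring.
(* [eta * L] is [L] V^N, which has the same parity as [L]. *)
have ceta : crossing_parity N eta = false.
  have := crossing_parity_Gamma L geta; rewrite /eta mulgVK cLk.
  by case: (crossing_parity N L); case: (crossing_parity N _).
exists (upper (- N%:Z) * eta)%g.
  apply/Gamma_elt; exists (1 - 2 * N%:Z), (-1 + N%:Z), 2, (-1).
  by rewrite /eta !eM !eV !upperE !lowerE -addnn PoszD; split; ring.
have N0 : (0 < N)%N by exact: ltnW (ltnW N2).
by rewrite crossing_parity_Gamma // ceta; have := cVk N.-1; rewrite prednK // => ->.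
Qed.

End NoncongruenceCharacter.

(** * The count by cases on N, and the noncongruence lift *)

Local Open Scope classical_set_scope.
Local Open Scope card_scope.

Theorem theorem1p1 (N : nat) (hN : (0 < N)%N) :
  ([set G : set SL2Z | congruence_lift (psl2_image (Gamma N)) G] #=
     `I_(if N == 1%N then 1%N
         else if odd N then 3%N
         else if N == 2%N then 5%N
         else 9%N))
  /\ ((2 < N)%N ->
      exists G : set SL2Z, noncongruence_lift (psl2_image (Gamma N)) G).
Proof.
split; last first.
  move=> N2; have [f [fM [A hA fA]]] := noncongruence_char N2.
  exists (char_lift N f); split; first exact: char_lift_lift.
  move=> cf; have hl := char_lift_lift fM.
  have fo : odd_at_opp1 N f by move=> /Gamma_opp1 /dvdn_leq => /(_ isT); rewrite leqNgt N2.
  have hNA : Gamma N A by apply: GammaS hA; rewrite -mul2n dvdn_mull.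
  have := congruence_lift_Gamma2 hN (conj hl cf) hA.
  by rewrite (char_liftE fM fo hNA) fA.
have [N1|N1] := eqVneq N 1%N.
  subst N; apply: (@card_congruence_lifts 1 1 void (fun _ _ => false)); rewrite ?card_void //.
  move=> f fM fo _.
  have G1 A : Gamma 1 A by apply/GammaP; rewrite !dvd1z.
  (* -1 is the square of [rot], so no character of SL2(Z) is odd at -1; only the full preimage
     remains. *)
  by have := char_sqr fM (G1 rot); rewrite rot_sqr fo.
have [oN|eN] := boolP (odd N).
  have N2 : (2 < N)%N by case: N oN hN N1 => [|[|[|]]].
  have fo f : odd_at_opp1 N f by move=> /Gamma_opp1 /dvdn_leq => /(_ isT); rewrite leqNgt N2.
  have oNz : oddz N%:Z = true by [].
  have sU : sgn2 (upper N%:Z) = true by rewrite /sgn2 !upperE oNz.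
  apply: (@card_congruence_lifts N 3 bool (fun a A => a && sgn2 A)); rewrite ?card_bool //.
  - by move=> a A B hA hB; rewrite (sgn2_char hA hB); case: a.
  - move=> a A hA; have h2 : 2 %| N.*2 by rewrite dvdn2 odd_double.
    by rewrite /sgn2 !(oddz_Gamma2 (GammaS h2 hA)) andbF.
  - by move=> a b /(_ _ (Gamma_upper (dvdzz N%:Z))); rewrite sU !andbT.
  - move=> f fM _ f2; exists (f (upper N%:Z)) => A hA; exact: odd_char_sgn2.
have [N2|N2] := eqVneq N 2%N.
  (* As -1 = 1 + 2 (-1), only its [c11] is nonzero. Oddness fixes the third coefficient and leaves
     four characters. *)
  have lo a b c : lin_char N a b c sl2_opp1 = c.
    by rewrite /lin_char !(@coordE N hN sl2_opp1 (-1) 0 0) ?eN1 ?N2 // !andbF andbT.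
  have go : Gamma N sl2_opp1 by apply/Gamma_opp1; rewrite N2.
  apply: (@card_congruence_lifts N 5 (bool * bool)%type
    (fun i => lin_char N i.1 i.2 true)); rewrite ?card_prod ?card_bool //.
  - by move=> i; exact: lin_char_char.
  - by move=> i _; exact: lo.
  - by move=> i A; exact: lin_char_Gamma2.
  - by move=> [a b] [a' b'] /(lin_char_inj hN)[-> ->].
  - move=> f fM fo f2; have [a [b [c h]]] := even_char_lin hN eN fM f2.
    exists (a, b) => A hA; rewrite h //=; congr (lin_char _ _ _ _).
    by rewrite -(lo a b c) -h // fo.
have N3 : (2 < N)%N by case: N hN eN N1 N2 => [|[|[|]]].
have fo f : odd_at_opp1 N f by move=> /Gamma_opp1 /dvdn_leq => /(_ isT); rewrite leqNgt N3.
apply: (@card_congruence_lifts N 9 (bool * bool * bool)%type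
  (fun i => lin_char N i.1.1 i.1.2 i.2)); rewrite ?card_prod ?card_bool //.
- by move=> i; exact: lin_char_char.
- by move=> i A; exact: lin_char_Gamma2.
- by move=> [[a b] c] [[a' b'] c'] /(lin_char_inj hN).
- move=> f fM _ f2; have [a [b [c h]]] := even_char_lin hN eN fM f2.
  by exists (a, b, c).
Qed.
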